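(* Suppose $L\ge s$, $M-L+1\ge s$ and $\|E\|_2<\sigma_s$. Then for all $\omega\in[0,1)$, $$|R^\varepsilon(\omega)-R(\omega)|\le\|\mathcal P_2^\varepsilon-\mathcal P_2\|_2:=\sup_{0\ne\phi\in\mathbb C^{L+1}}\frac{\|\mathcal P_2^\varepsilon\phi-\mathcal P_2\phi\|_2}{\|\phi\|_2}\le\frac{4\sigma_1+2\|E\|_2}{(\sigma_s-\|E\|_2)^2}\,\|E\|_2 .$$ In particular, for $\omega_j\in\mathcal S$ one has $R(\omega_j)=0$ and $$|R^\varepsilon(\omega_j)|\le\frac{2\|E\|_2}{x_{\min}\,\sigma_{\min}\big((\Phi^{M-L})^T\big)\,\|\phi^L(\omega_j)\|_2},\qquad j=1,2,\dots,s .$$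
   Context: Setting. Let $s,L,M$ be positive integers with $1\le L<M$. Let $\mathcal S=\{\omega_1,\dots,\omega_s\}\subset[0,1)$ be $s$ distinct frequencies and $x_1,\dots,x_s\in\mathbb C\setminus\{0\}$ amplitudes; $x_{\min}=\min_j|x_j|$. For a nonnegative integer $N$ put $\phi^{N}(\omega)=[1,\ e^{-2\pi i\omega},\dots,e^{-2\pi iN\omega}]^T\in\mathbb C^{N+1}$ and $\Phi^N=[\phi^N(\omega_1)\ \cdots\ \phi^N(\omega_s)]\in\mathbb C^{(N+1)\times s}$. The noiseless data are $y_k=\sum_{j=1}^s x_je^{-2\pi ik\omega_j}$, $k=0,\dots,M$; $\varepsilon=(\varepsilon_k)_{k=0}^M\in\mathbb C^{M+1}$ is an arbitrary noise vector and $y^\varepsilon=y+\varepsilon$. For $v\in\mathbb C^{M+1}$, $\mathrm{Hankel}(v)\in\mathbb C^{(L+1)\times(M-L+1)}$ has entries $v_{a+b}$, $0\le a\le L$, $0\le b\le M-L$. Put $H=\mathrm{Hankel}(y)=\Phi^L\,\mathrm{diag}(x_1,\dots,x_s)\,(\Phi^{M-L})^T$, $E=\mathrm{Hankel}(\varepsilon)$, $H^\varepsilon=\mathrm{Hankel}(y^\varepsilon)=H+E$. Write singular value decompositions (singular values in nonincreasing order) $H=[U_1\ U_2]\,\mathrm{diag}(\sigma_1,\dots,\sigma_s,0,\dots,0)\,[V_1\ V_2]^\star$ with $\sigma_1\ge\dots\ge\sigma_s>0$, and $H^\varepsilon=[U_1^\varepsilon\ U_2^\varepsilon]\,\mathrm{diag}(\sigma_1^\varepsilon,\sigma_2^\varepsilon,\dots)\,[V_1^\varepsilon\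 V_2^\varepsilon]^\star$, where $U_1,U_1^\varepsilon$ have $s$ columns and $U_2,U_2^\varepsilon$ have $L+1-s$ columns. Put $\mathcal P_2=U_2U_2^\star$, $\mathcal P_2^\varepsilon=U_2^\varepsilon(U_2^\varepsilon)^\star$ and $$R(\omega)=\frac{\|\mathcal P_2\phi^L(\omega)\|_2}{\|\phi^L(\omega)\|_2},\qquad R^\varepsilon(\omega)=\frac{\|\mathcal P^\varepsilon_2\phi^L(\omega)\|_2}{\|\phi^L(\omega)\|_2}.$$ $\|\cdot\|_2$ of a matrix is the spectral norm; $\sigma_{\min}(A)$ is the smallest nonzero singular value of $A$. *)

(* Defs.v *)
From mathcomp Require Import all_boot all_order all_algebra.
From mathcomp Require Import spectral sesquilinear complex.
From mathcomp Require Import boolp classical_sets functions reals trigo.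

Set Implicit Arguments.
Unset Strict Implicit.
Unset Printing Implicit Defensive.

Import Order.TTheory GRing.Theory Num.Theory.
Local Open Scope classical_set_scope.
Local Open Scope ring_scope.
Local Open Scope complex_scope.
Local Open Scope sesquilinear_scope.

Definition expi (R : realType) (t : R) : R[i] := cos t +i* sin t.

Definition modulus (R : realType) (z : R[i]) : R := Normc.normc z.

Definition l2norm (R : realType) (n : nat) (v : 'cV[R[i]]_n) : R :=
  Num.sqrt (\sum_(i < n) modulus (v i 0) ^+ 2).

Definition specnorm (R : realType) (m n : nat) (A : 'M[R[i]]_(m, n)) : R :=
  sup [set l2norm (A *m v) / l2norm v | v in [set v : 'cV[R[i]]_n | v != 0]].

(* [sigma i] is the (i+1)-st singular value; only the first [minn m n] values
   of [sigma] carry information, the others are unconstrained. *)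
Definition is_svd (R : realType) (m n : nat) (A : 'M[R[i]]_(m, n))
    (U : 'M[R[i]]_m) (sigma : nat -> R) (V : 'M[R[i]]_n) : Prop :=
  [/\ U \is unitarymx,
      V \is unitarymx,
      (forall i, (i < minn m n)%N -> 0 <= sigma i),
      (forall i j, (i <= j)%N -> (j < minn m n)%N -> sigma j <= sigma i) &
      A = U *m (\matrix_(i < m, j < n)
                  if i == j :> nat then (sigma i)%:C else 0) *m V ^t*].

Definition singular_value (R : realType) (m n : nat) (A : 'M[R[i]]_(m, n))
    (t : R) : Prop :=
  exists (U : 'M[R[i]]_m) (sigma : nat -> R) (V : 'M[R[i]]_n),
    is_svd A U sigma V /\ exists2 i, (i < minn m n)%N & t = sigma i.

(* For A != 0 the set is finite and nonempty, so this is its minimum. *)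
Definition sigma_min (R : realType) (m n : nat) (A : 'M[R[i]]_(m, n)) : R :=
  inf [set t : R | singular_value A t /\ t != 0].

Definition steering (R : realType) (N : nat) (w : R) : 'cV[R[i]]_N.+1 :=
  \col_(k < N.+1) expi (- (2 * pi * k%:R * w)).

Definition steering_mx (R : realType) (s N : nat) (omega : 'I_s -> R) :
    'M[R[i]]_(N.+1, s) :=
  \matrix_(k < N.+1, j < s) steering N (omega j) k 0.

Definition noiseless_data (R : realType) (s M : nat) (omega : 'I_s -> R)
    (x : 'I_s -> R[i]) : 'cV[R[i]]_M.+1 :=
  \col_(k < M.+1) \sum_(j < s) x j * expi (- (2 * pi * k%:R * omega j)).

(* For L <= M, a + b <= M always holds, so [inord (a + b)] has value a + b. *)
Definition hankel (R : realType) (M L : nat) (v : 'cV[R[i]]_M.+1) :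
    'M[R[i]]_(L.+1, (M - L).+1) :=
  \matrix_(a < L.+1, b < (M - L).+1) v (inord (a + b)) 0.

(* U_2, the last L + 1 - s columns of U: since j < L + 1 - s, [inord (s + j)]
   has value s + j. *)
Definition noise_basis (R : realType) (s L : nat) (U : 'M[R[i]]_L.+1) :
    'M[R[i]]_(L.+1, L.+1 - s) :=
  \matrix_(i < L.+1, j < L.+1 - s) U i (inord (s + j)).

Definition noise_proj (R : realType) (s L : nat) (U : 'M[R[i]]_L.+1) :
    'M[R[i]]_L.+1 :=
  noise_basis s U *m (noise_basis s U) ^t*.

Definition noise_correlation (R : realType) (L : nat) (P : 'M[R[i]]_L.+1)
    (w : R) : R :=
  l2norm (P *m steering L w) / l2norm (steering L w).

(* min_j |x_j|: the infimum of a finite set, nonempty when 0 < s. *)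
Definition min_modulus (R : realType) (s : nat) (x : 'I_s -> R[i]) : R :=
  inf (range (fun j => modulus (x j))).

(* Main.v *)
Require Import Defs.
From mathcomp Require Import all_boot all_order all_algebra.
From mathcomp Require Import spectral sesquilinear complex.
From mathcomp Require Import boolp classical_sets functions reals trigo.
From mathcomp Require Import perm ring lra.

Set Implicit Arguments.
Unset Strict Implicit.
Unset Printing Implicit Defensive.

Import Order.TTheory GRing.Theory Num.Theory.
Local Open Scope ring_scope.
Local Open Scope complex_scope.
Local Open Scope sesquilinear_scope.

(* The first bound is the reverse triangle inequality. For the second, write
   d = ||E||, P2' for the perturbed projection, and
     P2' - P2 = P2' (1 - P2) - (1 - P2') P2.
   Every vector of the range of 1 - P2 is H w with ||w|| <= ||u|| / sigma_s, and
   ||P2' H|| <= ||P2' H'|| + ||P2' E|| <= 2 d, since Weyl's inequality bounds the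
   (s+1)-st singular value of H' = H + E by d. Symmetrically, vectors of the
   range of 1 - P2' are H' w with ||w|| <= ||u|| / (sigma_s - d), and P2 H' = P2 E.
   Hence ||P2' - P2|| <= 2 d / sigma_s + d / (sigma_s - d), which is sharper than
   the claim. For the last bound, the steering vector at omega_j equals H w, where
   (Phi^(M-L))^T w = e_j / x_j has a solution of norm at most
   1 / (|x_j| sigma_min); then apply ||P2' H|| <= 2 d. *)

(** * Euclidean norm of complex columns, adjoints and the spectral norm *)

Section Norms.
Variable R : realType.
Local Notation C := R[i].

Lemma modulus_ge0 (z : C) : 0 <= modulus z.
Proof. by case: z => a b; exact: sqrtr_ge0. Qed.

Lemma modulusM (z w : C) : modulus (z * w) = modulus z * modulus w.
Proof. exact: Normc.normcM. Qed.

Lemma modulus0 : modulus (0 : C) = 0.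
Proof. exact: Normc.normc0. Qed.

Lemma modulus_real (a : R) : modulus a%:C = `|a|.
Proof. by rewrite /modulus /= expr0n addr0 sqrtr_sqr. Qed.

Lemma modulus_normE (z : C) : (modulus z)%:C = `|z|.
Proof. by []. Qed.

Lemma sqr_l2norm n (v : 'cV[C]_n) :
  l2norm v ^+ 2 = \sum_(i < n) modulus (v i 0) ^+ 2.
Proof. by rewrite sqr_sqrtr // sumr_ge0 // => i _; rewrite sqr_ge0. Qed.

Lemma l2norm_ge0 n (v : 'cV[C]_n) : 0 <= l2norm v.
Proof. exact: sqrtr_ge0. Qed.

Lemma sqr_l2normE n (v : 'cV[C]_n) :
  (l2norm v ^+ 2)%:C = (v^t* *m v) 0 0.
Proof.
rewrite sqr_l2norm !mxE rmorph_sum; apply: eq_bigr => i _.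
by rewrite !mxE rmorphXn /= modulus_normE normCK mulrC.
Qed.

(** Bridge to the Hermitian form [dotmx], which lives on row vectors, hence the transposes. The
    triangle and Cauchy-Schwarz inequalities are transferred through it. *)
Lemma l2norm_dotmx n (v : 'cV[C]_n) :
  (l2norm v)%:C = sqrtC (dotmx v^T v^T).
Proof.
have -> : dotmx v^T v^T = (l2norm v ^+ 2)%:C.
  rewrite sqr_l2normE dotmxE !mxE; apply: eq_bigr => i _.
  by rewrite !mxE mulrC.
by rewrite rmorphXn /= sqrCK // ler0c l2norm_ge0.
Qed.

Lemma l2norm0 n : l2norm (0 : 'cV[C]_n) = 0.
Proof.
by rewrite /l2norm big1 ?sqrtr0 // => i _; rewrite mxE modulus0 expr0n.
Qed.

Lemma l2norm_eq0 n (v : 'cV[C]_n) : (l2norm v == 0) = (v == 0).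
Proof.
apply/idP/eqP => [|->]; last by rewrite l2norm0.
rewrite -sqrf_eq0 sqr_l2norm psumr_eq0 => [/allP v0|i _]; last exact: sqr_ge0.
apply/colP => i; rewrite mxE; apply: Normc.eq0_normc.
by apply/eqP; rewrite -sqrf_eq0; exact/v0/mem_index_enum.
Qed.

Lemma l2norm_gt0 n (v : 'cV[C]_n) : (0 < l2norm v) = (v != 0).
Proof. by rewrite lt_def l2norm_ge0 andbT l2norm_eq0. Qed.

Lemma l2normN n (v : 'cV[C]_n) : l2norm (- v) = l2norm v.
Proof.
by rewrite /l2norm; under eq_bigr => i _ do rewrite mxE /modulus normcN.
Qed.

Lemma l2normZ n a (v : 'cV[C]_n) : l2norm (a *: v) = modulus a * l2norm v.
Proof.
rewrite /l2norm; under eq_bigr => i _ do rewrite mxE modulusM exprMn.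
by rewrite -mulr_sumr sqrtrM ?sqr_ge0 // sqrtr_sqr ger0_norm ?modulus_ge0.
Qed.

Lemma l2norm_delta n (j : 'I_n) : l2norm (delta_mx j 0 : 'cV[C]_n) = 1.
Proof.
rewrite /l2norm (bigD1 j) //= big1 => [|i ij].
  by rewrite mxE !eqxx /modulus Normc.normc1 expr1n addr0 sqrtr1.
by rewrite mxE (negbTE ij) modulus0 expr0n.
Qed.

Lemma ler_l2normD n (u v : 'cV[C]_n) : l2norm (u + v) <= l2norm u + l2norm v.
Proof.
rewrite -lecR rmorphD /= !l2norm_dotmx linearD /=.
exact: (triangle_lerif (@dotmx C n) u^T v^T).1.
Qed.

Lemma ler_l2norm_dist n (u v : 'cV[C]_n) :
  `|l2norm u - l2norm v| <= l2norm (u - v).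
Proof.
have h (a b : 'cV[C]_n) : l2norm a - l2norm b <= l2norm (a - b).
  by rewrite lerBlDr -[in l2norm a](subrK b a) ler_l2normD.
by rewrite ler_norml h andbT lerNl opprB -(l2normN (u - v)) opprB h.
Qed.

Lemma l2norm_cauchy_schwarz n (u v : 'cV[C]_n) :
  modulus ((u^t* *m v) 0 0) <= l2norm u * l2norm v.
Proof.
rewrite -lecR rmorphM /= !l2norm_dotmx modulus_normE mulrC.
have -> : (u^t* *m v) 0 0 = dotmx v^T u^T.
  rewrite dotmxE !mxE; apply: eq_bigr => i _.
  by rewrite !mxE mulrC.
exact: (CauchySchwarz_sqrt (@dotmx C n) v^T u^T).1.
Qed.

Lemma unitarymx_adjK n (U : 'M[C]_n) : U \is unitarymx -> U^t* *m U = 1%:M.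
Proof.
by rewrite -trmxC_unitary => /unitarymxP; rewrite trmxCK.
Qed.

Lemma mulmx_adjKV m n (U : 'M[C]_n) (v : 'M_(n, m)) :
  U \is unitarymx -> U^t* *m (U *m v) = v.
Proof. by move=> Uu; rewrite mulmxA unitarymx_adjK // mul1mx. Qed.

Lemma l2norm_unitary n (U : 'M[C]_n) (v : 'cV[C]_n) :
  U \is unitarymx -> l2norm (U *m v) = l2norm v.
Proof.
move=> Uu; apply/eqP; rewrite -(eqrXn2 (n := 2)) ?l2norm_ge0 //; apply/eqP.
apply: (@complexI R); by rewrite !sqr_l2normE trmx_mul map_mxM /= -mulmxA mulmx_adjKV.
Qed.

(** With w the image of u under the adjoint, ||w||^2 is the inner product of A w and u, at most t
    ||w|| ||u|| by Cauchy-Schwarz; then cancel ||w||. *)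
Lemma l2norm_adjoint_le m n (A : 'M[C]_(m, n)) (t : R) :
  0 <= t -> (forall v, l2norm (A *m v) <= t * l2norm v) ->
  forall u, l2norm (A^t* *m u) <= t * l2norm u.
Proof.
move=> t0 At u; set w := A^t* *m u.
have [->|w0] := eqVneq w 0; first by rewrite l2norm0 mulr_ge0 ?l2norm_ge0.
rewrite -(ler_pM2l (x := l2norm w)) ?l2norm_gt0 // -expr2.
have -> : l2norm w ^+ 2 = modulus (((A *m w)^t* *m u) 0 0).
  rewrite trmx_mul map_mxM /= -mulmxA -/w -sqr_l2normE modulus_real.
  by rewrite ger0_norm ?sqr_ge0.
apply: le_trans (l2norm_cauchy_schwarz _ _) _.
by rewrite mulrA ler_wpM2r ?l2norm_ge0 // mulrC At.
Qed.

(** The Frobenius norm serves as t, by Cauchy-Schwarz on each row. This makes the set under the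
    supremum in [specnorm] bounded above. *)
Lemma l2norm_mulmx_bounded m n (A : 'M[C]_(m, n)) :
  exists2 t, 0 <= t & forall v, l2norm (A *m v) <= t * l2norm v.
Proof.
exists (Num.sqrt (\sum_(i < m) l2norm ((row i A)^t*) ^+ 2)).
  exact: sqrtr_ge0.
move=> v; rewrite -(ler_pXn2r (n := 2)) ?nnegrE ?mulr_ge0 ?l2norm_ge0 ?sqrtr_ge0 //.
rewrite (sqr_l2norm (A *m v)) exprMn [X in _ <= X * _]sqr_sqrtr; last first.
  by rewrite sumr_ge0 // => i _; rewrite sqr_ge0.
rewrite mulr_suml; apply: ler_sum => i _.
rewrite -exprMn ler_pXn2r ?nnegrE ?modulus_ge0 ?mulr_ge0 ?l2norm_ge0 //.
apply: le_trans (l2norm_cauchy_schwarz _ _).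
by rewrite trmxCK -row_mul [(row _ _) 0 0]mxE lexx.
Qed.

Lemma l2norm_le_specnorm m n (A : 'M[C]_(m, n)) v :
  l2norm (A *m v) <= specnorm A * l2norm v.
Proof.
have [->|v0] := eqVneq v 0; first by rewrite mulmx0 !l2norm0 mulr0.
rewrite -ler_pdivrMr ?l2norm_gt0 //; apply: ub_le_sup; last by exists v.
have [t _ At] := l2norm_mulmx_bounded A.
by exists t => _ [w w0 <-]; rewrite ler_pdivrMr ?l2norm_gt0.
Qed.

Lemma specnorm_ge0 m n (A : 'M[C]_(m, n.+1)) : 0 <= specnorm A.
Proof.
pose v : 'cV[C]_n.+1 := const_mx 1.
have v0 : v != 0.
  by apply/eqP => /colP/(_ 0); rewrite !mxE => /eqP; rewrite oner_eq0.
rewrite -(pmulr_lge0 (x := l2norm v)) ?l2norm_gt0 //.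
exact: le_trans (l2norm_ge0 _) (l2norm_le_specnorm A v).
Qed.

(** The column count [n.+1] provides a nonzero vector, so the supremum is over a nonempty set. *)
Lemma specnorm_le m n (A : 'M[C]_(m, n.+1)) t :
  (forall v, l2norm (A *m v) <= t * l2norm v) -> specnorm A <= t.
Proof.
move=> At; apply: ge_sup.
  pose v : 'cV[C]_n.+1 := const_mx 1.
  exists (l2norm (A *m v) / l2norm v), v => //=.
  by apply/eqP => /colP/(_ 0); rewrite !mxE => /eqP; rewrite oner_eq0.
by move=> _ [w w0 <-]; rewrite ler_pdivrMr ?l2norm_gt0 ?At.
Qed.

End Norms.

(** * Coordinates indexed by all natural numbers, and rectangular diagonal matrices *)

Section Coordinates.
Variable R : realType.
Local Notation C := R[i].

(* Extending coordinates by 0 to all of nat compares vectors of different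
   dimensions, such as v and A *m v for a rectangular A. *)
Definition coef n (v : 'cV[C]_n) (k : nat) : C :=
  if insub k is Some i then v i 0 else 0.

Lemma coef_ord n (v : 'cV[C]_n) (i : 'I_n) : coef v i = v i 0.
Proof. by rewrite /coef valK. Qed.

Lemma coef_default n (v : 'cV[C]_n) k : (n <= k)%N -> coef v k = 0.
Proof. by move=> nk; rewrite /coef insubF // ltnNge nk. Qed.

Lemma coef_inj n (u v : 'cV[C]_n) : coef u =1 coef v -> u = v.
Proof. by move=> uv; apply/colP => i; rewrite -!coef_ord. Qed.

Lemma sqr_l2norm_coef n N (v : 'cV[C]_n) : (n <= N)%N ->
  l2norm v ^+ 2 = \sum_(k < N) modulus (coef v k) ^+ 2.
Proof.
move=> nN; rewrite sqr_l2norm.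
under eq_bigr => i _ do rewrite -coef_ord.
rewrite (big_ord_widen N (fun k => modulus (coef v k) ^+ 2)) // big_mkcond /=.
apply: eq_bigr => k _; case: ltnP => // nk.
by rewrite coef_default // modulus0 expr0n.
Qed.

Lemma coefZ n a (v : 'cV[C]_n) k : coef (a *: v) k = a * coef v k.
Proof. by rewrite /coef; case: insub => [i|]; rewrite ?mxE ?mulr0. Qed.

Lemma l2norm_ge_coef m n (u : 'cV[C]_m) (v : 'cV[C]_n) (t : R) : 0 <= t ->
  (forall k, t * modulus (coef u k) <= modulus (coef v k)) ->
  t * l2norm u <= l2norm v.
Proof.
move=> t0 uv; rewrite -(ler_pXn2r (n := 2)) ?nnegrE ?mulr_ge0 ?l2norm_ge0 //.
(* Both sums are padded with zeros to the common length [maxn m n] and compared termwise. *)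
rewrite exprMn (sqr_l2norm_coef _ (leq_maxl m n)).
rewrite (sqr_l2norm_coef _ (leq_maxr m n)) mulr_sumr; apply: ler_sum => k _.
by rewrite -exprMn ler_pXn2r ?nnegrE ?mulr_ge0 ?modulus_ge0.
Qed.

Lemma l2norm_le_coef m n (u : 'cV[C]_m) (v : 'cV[C]_n) (t : R) : 0 <= t ->
  (forall k, modulus (coef u k) <= t * modulus (coef v k)) ->
  l2norm u <= t * l2norm v.
Proof.
move=> t0 uv; rewrite -[t]ger0_norm // -modulus_real -l2normZ.
rewrite -[l2norm u]mul1r; apply: l2norm_ge_coef => // k; rewrite mul1r.
by rewrite coefZ modulusM modulus_real ger0_norm.
Qed.

Lemma coef_diag n (f : nat -> R) (v : 'cV[C]_n) k :
  coef (diag_mx (\row_i (f i)%:C) *m v) k = (f k)%:C * coef v k.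
Proof.
case: (ltnP k n) => kn; last by rewrite !coef_default // mulr0.
by rewrite -[k]/(val (Ordinal kn)) !coef_ord mul_diag_mx !mxE.
Qed.

(** The middle factor of [is_svd]. With [sigma] constantly 1 it also serves below as truncation or
    zero padding between dimensions. *)
Definition svd_mx m n (sigma : nat -> R) : 'M[C]_(m, n) :=
  \matrix_(i < m, j < n) if i == j :> nat then (sigma i)%:C else 0.

Lemma coef_svd_mx m n sigma (c : 'cV[C]_n) k :
  coef (svd_mx m n sigma *m c) k =
  if (k < minn m n)%N then (sigma k)%:C * coef c k else 0.
Proof.
case: (ltnP k m) => km; last first.
  by rewrite coef_default // ltnNge geq_min km.
rewrite -[k]/(val (Ordinal km)) coef_ord mxE.
case: (ltnP k n) => kn; last first.
  rewrite ltnNge geq_min /= kn orbT big1 // => j _; rewrite mxE ifF ?mul0r //.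
  by apply/negbTE; rewrite neq_ltn /= (leq_trans (ltn_ord j)) ?orbT.
rewrite leq_min /= km kn -[k]/(val (Ordinal kn)) coef_ord.
rewrite (bigD1 (Ordinal kn)) //= mxE eqxx big1 ?addr0 // => j jk.
by rewrite mxE ifF ?mul0r //; apply/negbTE; rewrite eq_sym; exact: jk.
Qed.

End Coordinates.

(** * Singular values: a min-max bound, Weyl's inequality and partial inverses *)

Lemma mulmx_wide_kernel (F : fieldType) k n (N : 'M[F]_(k, n)) : (k < n)%N ->
  exists2 v : 'cV_n, v != 0 & N *m v = 0.
Proof.
move=> kn; have : kermx N^T != 0.
  rewrite kermx_eq0 /row_free mxrank_tr; apply/negP => /eqP rN.
  by have := rank_leq_row N; rewrite rN leqNgt kn.
case/rowV0Pn => u /sub_kermxP uN u0; exists u^T; first by rewrite trmx_eq0.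
by rewrite -[N]trmxK -trmx_mul uN trmx0.
Qed.

Section SingularValues.
Variable R : realType.
Local Notation C := R[i].

Lemma svd_mulmx m n (A : 'M[C]_(m, n)) U sigma V (v : 'cV_n) : is_svd A U sigma V ->
  A *m v = U *m (svd_mx m n sigma *m (V^t* *m v)).
Proof. by case=> _ _ _ _ {1}->; rewrite !mulmxA. Qed.

Lemma l2norm_svd m n (A : 'M[C]_(m, n)) U sigma V v : is_svd A U sigma V ->
  l2norm (A *m v) = l2norm (svd_mx m n sigma *m (V^t* *m v)).
Proof. by move=> Asvd; rewrite (svd_mulmx _ Asvd) l2norm_unitary //; case: Asvd. Qed.

Lemma l2norm_svd_coord m n (A : 'M[C]_(m, n)) U sigma V v : is_svd A U sigma V ->
  l2norm (V^t* *m v) = l2norm v.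
Proof. by case=> _ Vu _ _ _; rewrite l2norm_unitary ?trmxC_unitary. Qed.

(** One half of the Courant-Fischer principle: the first k + 1 right singular vectors span a space
    of dimension k + 1, which meets the kernel of the k-row matrix N, and on this space A stretches
    by at least [sigma k]. *)
Lemma svd_min_image m n (A : 'M[C]_(m, n)) U sigma V k (N : 'M[C]_(k, n)) :
  is_svd A U sigma V -> (k < minn m n)%N ->
  exists v, [/\ v != 0, N *m v = 0 & sigma k * l2norm v <= l2norm (A *m v)].
Proof.
move=> Asvd kmn; have [_ Vu s_ge0 s_dec _] := Asvd.
(* [W] pads k + 1 coordinates with zeros to length n, so the columns of [V *m W] are the leading
   right singular vectors. *)
pose W : 'M[C]_(n, k.+1) := svd_mx n k.+1 (fun=> 1).
have kn : (k < n)%N by apply: leq_trans kmn (geq_minr _ _).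
have [a a0 Na] := mulmx_wide_kernel (N *m V *m W) (ltnSn k).
have Wa j : coef (W *m a) j = if (j <= k)%N then coef a j else 0.
  by rewrite coef_svd_mx (minn_idPr _) // ltnS rmorph1 mul1r.
exists (V *m (W *m a)); split.
- rewrite -l2norm_eq0 l2norm_unitary // l2norm_eq0.
  apply: contraNneq a0 => Wa0; apply/eqP/coef_inj => j.
  case: (leqP j k) => jk; last by rewrite !coef_default.
  have := Wa j; rewrite Wa0 jk => <-; rewrite /coef.
  by do 2!case: insub => [?|//]; rewrite ?mxE.
- by rewrite !mulmxA.
rewrite (l2norm_svd _ Asvd) l2norm_unitary // mulmx_adjKV //.
apply: l2norm_ge_coef => [|j]; first exact: s_ge0.
rewrite Wa coef_svd_mx Wa; case: (leqP j k) => jk; last first.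
  by rewrite modulus0 mulr0 modulus_ge0.
have jmn : (j < minn m n)%N by exact: leq_ltn_trans kmn.
by rewrite jmn modulusM modulus_real ger0_norm ?s_ge0 // ler_wpM2r ?modulus_ge0 ?s_dec.
Qed.

(** Only singular values at nonzero coordinates of v are constrained, so the bound is sharp enough
    for vectors orthogonal to the leading right singular vectors. *)
Lemma l2norm_svd_le m n (A : 'M[C]_(m, n)) U sigma V t v :
  is_svd A U sigma V -> 0 <= t ->
  (forall j, (j < minn m n)%N -> coef (V^t* *m v) j != 0 -> sigma j <= t) ->
  l2norm (A *m v) <= t * l2norm v.
Proof.
move=> Asvd t0 vt; have [_ _ s_ge0 _ _] := Asvd.
rewrite (l2norm_svd _ Asvd) -(l2norm_svd_coord v Asvd).
apply: l2norm_le_coef => // j; rewrite coef_svd_mx.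
case: ifP => jmn; last by rewrite modulus0 mulr_ge0 ?modulus_ge0.
rewrite modulusM modulus_real ger0_norm ?s_ge0 //.
have [->|cj0] := eqVneq (coef (V^t* *m v) j) 0; first by rewrite modulus0 !mulr0.
by rewrite ler_wpM2r ?modulus_ge0 ?vt.
Qed.

(** Weyl's inequality. Let N extract the first k coordinates in the basis [VB]. Some nonzero v in
    its kernel satisfies ||A v|| >= [sigmaA k] ||v||, while every v there satisfies ||B v|| <=
    [sigmaB k] ||v||. *)
Lemma singular_value_perturbation m n (A B : 'M[C]_(m, n))
    UA sigmaA VA UB sigmaB VB d k :
  is_svd A UA sigmaA VA -> is_svd B UB sigmaB VB -> (k < minn m n)%N ->
  (forall v, l2norm (A *m v - B *m v) <= d * l2norm v) ->
  sigmaA k <= sigmaB k + d.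
Proof.
move=> Asvd Bsvd kmn ABd; have [_ _ s_ge0 s_dec _] := Bsvd.
pose N : 'M[C]_(k, n) := svd_mx k n (fun=> 1) *m VB^t*.
have [v [v0 Nv Av]] := svd_min_image N Asvd kmn.
have Bv : l2norm (B *m v) <= sigmaB k * l2norm v.
  apply: (l2norm_svd_le Bsvd) => [|j jmn]; first exact: s_ge0.
  case: (leqP k j) => kj; first by rewrite s_dec.
  (* For j < k, coordinate j of v in the basis [VB] is an entry of N v = 0. *)
  have := coef_svd_mx k (fun=> 1) (VB^t* *m v) j.
  rewrite mulmxA -/N Nv leq_min kj (leq_trans jmn (geq_minr m n)) mul1r /= => <-.
  by rewrite /coef; case: insub => [i|]; rewrite ?mxE eqxx.
rewrite -(ler_pM2r (x := l2norm v)) ?l2norm_gt0 //; apply: (le_trans Av).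
rewrite mulrDl -[A *m v](subrK (B *m v)) addrC.
by apply: le_trans (ler_l2normD _ _) _; rewrite lerD.
Qed.

(** Weyl's inequality in both directions with d = 0. *)
Lemma singular_value_uniq m n (A : 'M[C]_(m, n)) U1 sigma1 V1 U2 sigma2 V2 k :
  is_svd A U1 sigma1 V1 -> is_svd A U2 sigma2 V2 -> (k < minn m n)%N ->
  sigma1 k = sigma2 k.
Proof.
move=> A1 A2 kmn; apply/eqP; rewrite eq_le.
by apply/andP; split; rewrite -[leRHS]addr0;
  [apply: (singular_value_perturbation A1 A2) |
   apply: (singular_value_perturbation A2 A1)] => // v;
  rewrite subrr l2norm0 mul0r.
Qed.

(** The kernel condition says that A factors through k dimensions. The vector of [svd_min_image] is
    then killed by A, which forces [sigma k], and all later values, to be 0. *)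
Lemma svd_rank_le m n (A : 'M[C]_(m, n)) U sigma V k (N : 'M[C]_(k, n)) j :
  is_svd A U sigma V -> (forall v : 'cV_n, N *m v = 0 -> A *m v = 0) ->
  (k <= j)%N -> (j < minn m n)%N -> sigma j = 0.
Proof.
move=> Asvd NA kj jmn; have [_ _ s_ge0 s_dec _] := Asvd.
have kmn := leq_ltn_trans kj jmn.
have [v [v0 /NA Av]] := svd_min_image N Asvd kmn.
rewrite Av l2norm0 pmulr_lle0 ?l2norm_gt0 // => sk0.
by apply/eqP; rewrite eq_le s_ge0 // andbT; apply: le_trans sk0; exact: s_dec.
Qed.

(** Inverting the r leading singular values solves A w = p, where p is the projection of u on the
    first r left singular vectors. Counting from 0, the smallest value inverted is [sigma r.-1],
    which gives the norm bound. *)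
Lemma svd_section m n (A : 'M[C]_(m, n)) U sigma V r (u : 'cV_m) :
  is_svd A U sigma V -> (0 < r <= minn m n)%N -> 0 < sigma r.-1 ->
  exists2 w, A *m w = U *m diag_mx (\row_i ((i < r)%:R)%:C) *m U^t* *m u &
    l2norm w <= (sigma r.-1)^-1 * l2norm u.
Proof.
move=> Asvd /andP[r0 rmn] sr0; have [Uu Vu s_ge0 s_dec _] := Asvd.
have s_r j : (j < r)%N -> sigma r.-1 <= sigma j.
  move=> jr; apply: s_dec; last by rewrite prednK.
  by rewrite -ltnS prednK.
(* Coordinates of w in the basis V. The factor [(i < r)%:R] discards the indices where [sigma] may
   vanish or carry no information. *)
pose c : 'cV[C]_n :=
  diag_mx (\row_i ((i < r)%:R / sigma i)%:C) *m (svd_mx n m (fun=> 1) *m (U^t* *m u)).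
have cE j : coef c j = (if (j < r)%N then (sigma j)^-1 else 0)%:C * coef (U^t* *m u) j.
  rewrite (coef_diag (fun j => (j < r)%:R / sigma j)) coef_svd_mx minnC.
  case: ltnP => jr; last by rewrite mulr0n !mul0r.
  by rewrite (leq_trans jr rmn) !mul1r.
exists (V *m c).
  rewrite (svd_mulmx _ Asvd) -!mulmxA; congr (U *m _); apply: coef_inj => j.
  rewrite mulmx_adjKV //.
  rewrite coef_svd_mx cE (coef_diag (fun j => (j < r)%:R)).
  case: (ltnP j r) => jr; last by rewrite mulr0n !mul0r mulr0 if_same.
  rewrite (leq_trans jr rmn) mul1r mulrA -rmorphM /= divff ?rmorph1 ?mul1r //.
  by rewrite gt_eqF // (lt_le_trans sr0) // s_r.
rewrite l2norm_unitary // -(l2norm_unitary (U := U^t*) u) ?trmxC_unitary //.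
apply: l2norm_le_coef => [|j]; first by rewrite invr_ge0 ltW.
rewrite cE modulusM ler_wpM2r ?modulus_ge0 // modulus_real.
case: ltnP => jr; last by rewrite normr0 invr_ge0 ltW.
have sj0 : 0 < sigma j by rewrite (lt_le_trans sr0) // s_r.
by rewrite gtr0_norm ?invr_gt0 // lef_pV2 ?posrE // s_r.
Qed.

End SingularValues.

(** * The projection onto the noise space *)

Section NoiseProjection.
Variable R : realType.
Local Notation C := R[i].

(** Reindexing the columns s + j by l = s + j turns the projection into a 0-1 diagonal matrix in the
    basis U, to which the coordinate lemmas apply. *)
Lemma noise_projE s L (U : 'M[C]_L.+1) :
  noise_proj s U = U *m diag_mx (\row_i ((s <= i)%:R)%:C) *m U^t*.
Proof.
apply/matrixP => i k; rewrite !mxE.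
pose F l := U i (inord l) * (U k (inord l))^*.
transitivity (\sum_(s <= l < L.+1) F l).
  rewrite (big_addn 0 L.+1 s) big_mkord; apply: eq_bigr => j _.
  by rewrite !mxE /F addnC.
rewrite (big_nat_widenl _ 0) // big_mkord big_mkcond /=.
apply: eq_bigr => l _; rewrite mul_mx_diag !mxE /F inord_val.
by case: leqP => _; rewrite ?mulr0n ?mulr0 ?mul0r // mulr1n mulr1.
Qed.

Lemma noise_projC s L (U : 'M[C]_L.+1) : U \is unitarymx ->
  1%:M - noise_proj s U = U *m diag_mx (\row_i ((i < s)%:R)%:C) *m U^t*.
Proof.
move=> Uu; rewrite noise_projE -[1%:M](unitarymxP Uu) -[X in X *m _ - _]mulmx1.
rewrite -mulmxBl -mulmxBr; congr (_ *m _ *m _).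
apply/matrixP => i j; rewrite !mxE.
by case: eqP => _; case: leqP; rewrite ?mulr0n ?mulr1n ?subr0 ?subrr.
Qed.

Lemma noise_proj_adj s L (U : 'M[C]_L.+1) : (noise_proj s U)^t* = noise_proj s U.
Proof. by rewrite /noise_proj trmx_mul map_mxM /= trmxCK. Qed.

Lemma l2norm_noise_proj s L (U : 'M[C]_L.+1) v :
  U \is unitarymx -> l2norm (noise_proj s U *m v) <= l2norm v.
Proof.
move=> Uu; rewrite noise_projE -!mulmxA l2norm_unitary //.
rewrite -(l2norm_unitary (U := U^t*) v) ?trmxC_unitary // -[leRHS]mul1r.
apply: l2norm_le_coef => // k; rewrite (coef_diag (fun k => (s <= k)%:R)) modulusM.
rewrite ler_wpM2r ?modulus_ge0 // modulus_real.
by case: leqP => _; rewrite ?normr0 ?normr1.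
Qed.

(** The projection removes the first s left singular directions, so only singular values of index at
    least s act on v. *)
Lemma l2norm_noise_proj_svd s L n (A : 'M[C]_(L.+1, n)) U sigma V t v :
  is_svd A U sigma V -> 0 <= t ->
  (forall j, (s <= j)%N -> (j < minn L.+1 n)%N -> sigma j <= t) ->
  l2norm (noise_proj s U *m (A *m v)) <= t * l2norm v.
Proof.
move=> Asvd t0 st; have [Uu _ s_ge0 _ _] := Asvd.
rewrite noise_projE (svd_mulmx _ Asvd) -!mulmxA l2norm_unitary // mulmx_adjKV //.
rewrite -(l2norm_svd_coord v Asvd); apply: l2norm_le_coef => // j.
rewrite (coef_diag (fun k => (s <= k)%:R)) coef_svd_mx.
case: (leqP s j) => sj; last by rewrite mulr0n mul0r modulus0 mulr_ge0 ?modulus_ge0.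
rewrite mul1r; case: ifP => jmn; last by rewrite modulus0 mulr_ge0 ?modulus_ge0.
by rewrite modulusM ler_wpM2r ?modulus_ge0 // modulus_real ger0_norm ?s_ge0 ?st.
Qed.

(** The complementary projection is that onto the first s left singular vectors, so [svd_section]
    applies with r = s. *)
Lemma noise_proj_complement s L n (A : 'M[C]_(L.+1, n)) U sigma V (u : 'cV_L.+1) :
  is_svd A U sigma V -> (0 < s <= minn L.+1 n)%N -> 0 < sigma s.-1 ->
  exists2 w, u - noise_proj s U *m u = A *m w &
    l2norm w <= (sigma s.-1)^-1 * l2norm u.
Proof.
move=> Asvd smn ss0; have [w Aw wu] := svd_section u Asvd smn ss0.
exists w => //; rewrite Aw -noise_projC ?mulmxBl ?mul1mx //.
by case: Asvd.
Qed.

(** * Perturbation of the noise projection, with [A] and [B] in the roles of [H] and [Heps] *)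

Section Perturbation.
Variables (s L n : nat) (A B : 'M[C]_(L.+1, n)) (UA UB : 'M[C]_L.+1).
Variables (sigmaA sigmaB : nat -> R) (VA VB : 'M[C]_n) (d : R).
Hypotheses (Asvd : is_svd A UA sigmaA VA) (Bsvd : is_svd B UB sigmaB VB).
Hypothesis smn : (0 < s <= minn L.+1 n)%N.
Hypothesis rankA : forall j, (s <= j)%N -> (j < minn L.+1 n)%N -> sigmaA j = 0.
Hypothesis d_ge0 : 0 <= d.
Hypothesis AB : forall v : 'cV_n, l2norm (B *m v - A *m v) <= d * l2norm v.

Lemma noise_proj_rank (v : 'cV_n) : noise_proj s UA *m (A *m v) = 0.
Proof.
apply/eqP; rewrite -l2norm_eq0 eq_le l2norm_ge0 andbT -(mul0r (l2norm v)).
by apply: (l2norm_noise_proj_svd _ Asvd) => // j sj jmn; rewrite rankA.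
Qed.

Lemma l2norm_perturbed_noise_proj (v : 'cV_n) :
  l2norm (noise_proj s UB *m (A *m v)) <= 2 * d * l2norm v.
Proof.
have [UBu _ _ _ _] := Bsvd.
(* A v = B v - (B v - A v), and each term contributes d: the first by Weyl's inequality and [rankA],
   the second because a projection is a contraction. *)
rewrite -[A *m v](subKr (B *m v)) mulmxBr; apply: le_trans (ler_l2normD _ _) _.
rewrite l2normN mulr_natl mulr2n mulrDl lerD //.
  apply: (l2norm_noise_proj_svd _ Bsvd) => // j sj jmn.
  rewrite -[d]add0r -(rankA sj jmn).
  exact: (singular_value_perturbation Bsvd Asvd).
exact: le_trans (l2norm_noise_proj _ _ UBu) (AB v).
Qed.

Hypothesis d_lt : d < sigmaA s.-1.

Lemma noise_proj_perturbation (v : 'cV_L.+1) :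
  l2norm ((noise_proj s UB - noise_proj s UA) *m v) <=
    (2 * d / sigmaA s.-1 + d / (sigmaA s.-1 - d)) * l2norm v.
Proof.
have [UBu _ _ _ _] := Bsvd; have [UAu _ _ _ _] := Asvd.
have sA0 : 0 < sigmaA s.-1 by apply: le_lt_trans d_lt.
have sBd : 0 < sigmaA s.-1 - d by rewrite subr_gt0.
have sB : sigmaA s.-1 - d <= sigmaB s.-1.
  rewrite lerBlDr; apply: (singular_value_perturbation Asvd Bsvd).
    by case/andP: smn => s0; apply: leq_trans; rewrite prednK.
  by move=> w; rewrite -opprB l2normN.
set PA := noise_proj s UA; set PB := noise_proj s UB.
have -> : PB - PA = PB *m (1%:M - PA) + - ((1%:M - PB) *m PA).
  by rewrite mulmxBr mulmx1 mulmxBl mul1mx opprB addrA subrK.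
rewrite mulmxDl mulNmx; apply: le_trans (ler_l2normD _ _) _.
rewrite l2normN mulrDl; apply: lerD.
  have [w Aw wv] := noise_proj_complement v Asvd smn sA0.
  rewrite -mulmxA mulmxBl mul1mx Aw; apply: le_trans (l2norm_perturbed_noise_proj w) _.
  by rewrite -[leRHS]mulrA ler_wpM2l ?mulr_ge0.
(* Passing to the adjoint puts [1 - PB] on the right, where its values can be written as B w. *)
have -> : (1%:M - PB) *m PA = (PA *m (1%:M - PB))^t*.
  rewrite trmx_mul map_mxM /= noise_proj_adj; congr (_ *m _).
  by rewrite raddfB /= map_mxB noise_proj_adj trmx1 map_mx1.
apply: l2norm_adjoint_le => [|u]; first by rewrite divr_ge0 // ltW.
have sB0 := lt_le_trans sBd sB.
have [w Bw wu] := noise_proj_complement u Bsvd smn sB0.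
(* [PA] kills A w, so only the difference B w - A w remains. *)
rewrite -mulmxA mulmxBl mul1mx Bw -[B *m w](subrK (A *m w)) mulmxDr noise_proj_rank.
rewrite addr0; apply: le_trans (l2norm_noise_proj _ _ UAu) _.
apply: le_trans (AB w) _; rewrite -[leRHS]mulrA ler_wpM2l //.
apply: le_trans wu _; rewrite ler_wpM2r ?l2norm_ge0 //.
by rewrite lef_pV2 ?posrE.
Qed.

End Perturbation.
End NoiseProjection.

(** * Existence of a singular value decomposition for matrices with independent rows *)

Section Existence.
Variable R : realType.
Local Notation C := R[i].

(** The orthonormal rows of W are completed by a Gram-Schmidt basis of their orthogonal complement,
    the kernel of the adjoint. *)
Lemma unitarymx_complete m n (W : 'M[C]_(m, n)) : W \is unitarymx ->
  exists2 Q : 'M[C]_n, Q \is unitarymx &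
    forall (i : 'I_m) (j : 'I_n), i = j :> nat -> row j Q = row i W.
Proof.
move=> Wu; pose K := kermx (W^t*); pose N := schmidt (row_base K).
have Nu : N \is unitarymx by rewrite schmidt_unitarymx // rank_leq_row.
have NW : N *m W^t* = 0.
  apply/sub_kermxP; rewrite -/K -(eq_row_base K).
  by rewrite eqmx_schmidt_free // row_base_free.
have mrn : (m + \rank K = n)%N.
  rewrite mxrank_ker mxrank_map mxrank_tr mxrank_unitary // subnKC //.
  by rewrite -(mxrank_unitary Wu) rank_leq_col.
have Xu : col_mx W N \is unitarymx.
  apply/unitarymxP; rewrite tr_col_mx map_row_mx mul_col_row.
  rewrite (unitarymxP Wu) (unitarymxP Nu) NW.
  have -> : W *m N^t* = (N *m W^t*)^t* by rewrite trmx_mul map_mxM /= trmxCK.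
  by rewrite NW trmx0 map_mx0 -scalar_mx_block.
(* The stacked matrix has [m + \rank K] rows, equal to n only propositionally; a variable row count
   k lets the equation be substituted. *)
suff h k (X : 'M[C]_(k, n)) : k = n -> X \is unitarymx ->
    (forall (i : 'I_m) (j : 'I_k), i = j :> nat -> row j X = row i W) ->
    exists2 Q : 'M[C]_n, Q \is unitarymx &
      forall (i : 'I_m) (j : 'I_n), i = j :> nat -> row j Q = row i W.
  apply: (h _ _ mrn Xu) => i j ij.
  have jE : j = lshift (\rank K) i by apply: ord_inj; rewrite -ij.
  by rewrite jE rowKu.
by move=> kn; subst k; exists X.
Qed.

Lemma sorting_perm n (f : 'I_n -> R) :
  exists p : 'S_n, forall i j : 'I_n, (i <= j)%N -> f (p j) <= f (p i).
Proof.
pose e (i j : 'I_n) := f j <= f i.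
pose r := sort e (enum 'I_n).
have rsize : size r = n by rewrite size_sort size_enum_ord.
(* The default of [nth] is the index itself, an element of ['I_n] at hand even though n may be 0; it
   is never returned, as i < [size r]. *)
have r_inj : injective (fun i : 'I_n => nth i r i).
  move=> i j; rewrite (set_nth_default i j) ?rsize // => /eqP.
  by rewrite nth_uniq ?rsize ?sort_uniq ?enum_uniq // => /eqP/val_inj.
exists (perm r_inj) => i j ij; rewrite !permE (set_nth_default i j) ?rsize //.
have e_total : total e by move=> a b; exact: le_total.
have e_trans : transitive e by move=> a b c ba ac; exact: le_trans ac ba.
apply: (sorted_leq_nth e_trans _ _ (sort_sorted e_total _)) => //.
- by move=> a; exact: lexx.
- by rewrite inE rsize.
- by rewrite inE rsize.
Qed.

Lemma row_perm_gram m n (X : 'M[C]_(m, n)) (p : 'S_m) i j :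
  (row_perm p X *m (row_perm p X)^t*) i j = (X *m X^t*) (p i) (p j).
Proof. by rewrite !mxE; apply: eq_bigr => k _; rewrite !mxE. Qed.

(** Let P diagonalise A times its adjoint. Then the rows of P A are orthogonal, and nonzero since A
    has independent rows. Their norms, sorted, are the singular values; the normalised rows,
    completed to a unitary Q, give the right factor. This is needed because [sigma_min] refers to
    singular values only through existing decompositions. *)
Lemma exists_svd_row_free m n (A : 'M[C]_(m, n)) : row_free A ->
  exists U sigma V, is_svd A U sigma V /\ forall i, (i < m)%N -> 0 < sigma i.
Proof.
move=> Afree; have mn : (m <= n)%N by rewrite -(eqP Afree) rank_leq_col.
pose G := A *m A^t*; pose P := spectralmx G; pose D := spectral_diag G.
have Gherm : G \is hermsymmx.
  by apply/is_hermitianmxP; rewrite expr0 scale1r /G trmx_mul map_mxM /= trmxCK.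
have Pu : P \is unitarymx by exact: spectral_unitarymx.
have PA : (P *m A) *m (P *m A)^t* = diag_mx D.
  have /orthomx_spectralP GE := hermitian_normalmx Gherm.
  rewrite trmx_mul map_mxM /= mulmxA -(mulmxA P) -/G GE -/P -/D.
  by rewrite invmx_unitary // !mulmxA mulmxtVK // (unitarymxP Pu) mul1mx.
pose f i := l2norm ((row i (P *m A))^t*).
have f_gt0 i : 0 < f i.
  rewrite l2norm_gt0; apply/eqP => /(congr1 (fun M => M^t*)).
  rewrite trmxCK trmx0 map_mx0 rowE => /eqP.
  rewrite mulmxA mulmx_free_eq0 // mulmx_free_eq0; last first.
    by rewrite row_free_unit unitarymx_unit.
  by apply/negP/eqP => /matrixP/(_ 0 i); rewrite !mxE !eqxx => /eqP; rewrite oner_eq0.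
have [p p_dec] := sorting_perm f.
pose B := row_perm p (P *m A).
have BB i j : (B *m B^t*) i j = (f (p i) ^+ 2 *+ (i == j))%:C.
  rewrite row_perm_gram; have [->|ij] := eqVneq i j.
    rewrite mulr1n /f sqr_l2normE trmxCK !mxE; apply: eq_bigr => k _.
    by rewrite !mxE.
  by rewrite PA mxE (inj_eq perm_inj) (negbTE ij) !mulr0n.
pose W := diag_mx (\row_i ((f (p i))^-1)%:C) *m B.
have Wu : W \is unitarymx.
  apply/unitarymxP; rewrite /W trmx_mul map_mxM /= mulmxA -(mulmxA _ B).
  rewrite tr_diag_mx map_diag_mx; apply/matrixP => i j.
  rewrite mul_mx_diag mxE mul_diag_mx mxE BB !mxE.
  have [->|ij] := eqVneq i j; last by rewrite !mulr0n mulr0 mul0r.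
  rewrite !mulr1n -rmorphM /= conj_Creal ?complex_real // -rmorphM /=.
  rewrite expr2 mulrA mulVf ?gt_eqF //.
  by rewrite mul1r divff ?gt_eqF.
have [Q Qu QW] := unitarymx_complete Wu.
pose sigma k := if insub k is Some i then f (p i) else 0.
have sigma_ord (i : 'I_m) : sigma i = f (p i) by rewrite /sigma valK.
have sigma_gt0 i : (i < m)%N -> 0 < sigma i.
  by move=> im; rewrite -[ i ]/(val (Ordinal im)) sigma_ord.
have P'u : row_perm p P \is unitarymx.
  apply/unitarymxP/matrixP => i j.
  by rewrite row_perm_gram (unitarymxP Pu) !mxE (inj_eq perm_inj).
exists ((row_perm p P)^t*), sigma, (Q^t*); split; last exact: sigma_gt0.
split.
- by rewrite trmxC_unitary.
- by rewrite trmxC_unitary.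
- by move=> i im; rewrite ltW // sigma_gt0 // (leq_trans im) // geq_minl.
- move=> i j ij jm; have {}jm := leq_trans jm (geq_minl m n).
  rewrite -[j]/(val (Ordinal jm)) -[ i ]/(val (Ordinal (leq_ltn_trans ij jm))).
  by rewrite !sigma_ord p_dec.
rewrite trmxCK -mulmxA.
(* The first m rows of Q are those of B divided by their norms, and the diagonal factor restores
   these norms. *)
have -> : (\matrix_(i < m, j < n) if i == j :> nat then (sigma i)%:C else 0) *m Q = B.
  apply/matrixP => i k; rewrite !mxE (bigD1 (widen_ord mn i)) //= !mxE eqxx.
  have -> : Q (widen_ord mn i) k = (f (p i))^-1%:C * B i k.
    have : Q (widen_ord mn i) k = row i W 0 k.
      by rewrite -(QW i (widen_ord mn i) erefl) mxE.
    by move=> ->; rewrite mxE /W mul_diag_mx mxE [X in X * _]mxE.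
  rewrite big1 ?addr0 => [|j ji]; last first.
    by rewrite mxE ifF ?mul0r //; apply/negbTE; rewrite eq_sym; exact: ji.
  by rewrite sigma_ord mulrA -rmorphM /= divff ?gt_eqF // mul1r !mxE.
have -> : B = row_perm p P *m A by rewrite /B !row_permE mulmxA.
by rewrite mulmx_adjKV.
Qed.
End Existence.

(** * The smallest nonzero singular value as a bound on right inverses *)

Section SmallestSingularValue.
Variable R : realType.
Local Notation C := R[i].

(** By uniqueness, any decomposition yields the same values; the last one is the least and is
    positive, so the infimum is attained there. *)
Lemma sigma_min_svd m n (A : 'M[C]_(m, n)) U sigma V :
  is_svd A U sigma V -> (0 < m <= n)%N -> 0 < sigma m.-1 ->
  sigma_min A = sigma m.-1.
Proof.
move=> Asvd /andP[m0 mn] s0; have [_ _ _ s_dec _] := Asvd.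
have mE : minn m n = m by exact/minn_idPl.
set S : set R := fun t => singular_value A t /\ t != 0.
have Ss : S (sigma m.-1).
  split; last by rewrite gt_eqF.
  by exists U, sigma, V; split=> //; exists m.-1; rewrite ?mE ?prednK.
have lbS : lbound S (sigma m.-1).
  move=> _ [[U' [sigma' [V' [Asvd' [i imn ->]]]]] _].
  rewrite (singular_value_uniq Asvd' Asvd imn).
  rewrite mE in imn; apply: s_dec; last by rewrite mE prednK.
  by rewrite -ltnS prednK.
rewrite /sigma_min -/S; apply/eqP; rewrite eq_le; apply/andP; split.
  by apply: ge_inf Ss; exists (sigma m.-1).
by apply: lb_le_inf lbS; exists (sigma m.-1).
Qed.

(** The case r = m of [svd_section], where the projection is the identity. *)
Lemma sigma_min_section m n (A : 'M[C]_(m, n)) : row_free A -> (0 < m)%N ->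
  0 < sigma_min A /\ forall u : 'cV_m,
    exists2 w, A *m w = u & l2norm w <= (sigma_min A)^-1 * l2norm u.
Proof.
move=> Afree m0; have [U [sigma [V [Asvd s_gt0]]]] := exists_svd_row_free Afree.
have mn : (m <= n)%N by rewrite -(eqP Afree) rank_leq_col.
have sm_gt0 : 0 < sigma m.-1 by rewrite s_gt0 // prednK.
rewrite (sigma_min_svd Asvd) ?m0 //; split=> // u.
have rmn : (0 < m <= minn m n)%N by rewrite m0 (minn_idPl mn) /=.
have [w Aw wu] := svd_section u Asvd rmn sm_gt0; exists w => //.
rewrite Aw; have -> : \row_(i < m) ((i < m)%:R)%:C = const_mx 1 :> 'rV[C]_m.
  by apply/rowP => i; rewrite !mxE ltn_ord.
have [Uu _ _ _ _] := Asvd.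
by rewrite diag_const_mx mulmx1 (unitarymxP Uu) mul1mx.
Qed.

End SmallestSingularValue.

(** * Steering vectors: Vandermonde structure and factorisation of the Hankel matrix *)

Section Steering.
Variable R : realType.
Local Notation C := R[i].

Lemma expi0 : expi (0 : R) = 1.
Proof. by rewrite /expi cos0 sin0. Qed.

Lemma expiD (a b : R) : expi (a + b) = expi a * expi b.
Proof.
by rewrite /expi cosD sinD; simpc; congr (_ +i* _); rewrite addrC.
Qed.

Lemma expi_natmul (k : nat) (a : R) : expi (a *+ k) = expi a ^+ k.
Proof.
by elim: k => [|k IH]; rewrite ?mulr0n ?expi0 // mulrS expiD IH exprS.
Qed.

(** If a > 0, then a/2 lies strictly between 0 and pi, so sin (a/2) > 0, whereas cos a = 1 forces
    sin (a/2)^2 = 0 by the double angle formula. *)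
Lemma expi_eq1 (a : R) : 0 <= a < 2 * pi -> expi a = 1 -> a = 0.
Proof.
move=> /andP[a0 a2] [ca _]; apply/eqP; rewrite eq_le a0 andbT leNgt.
apply/negP => {a0} a0; have : 0 < sin (a / 2).
  by apply: sin_gt0_pi; apply/andP; split; lra.
rewrite lt_def => /andP[+ _]; rewrite -sqrf_eq0 sin2cos2.
have := cos_mulr2n (a / 2); rewrite -[(a / 2) *+ 2]mulr_natr divfK ?pnatr_eq0 //.
by rewrite ca => /eqP; lra.
Qed.

Lemma expi_inj_range (a b : R) : 0 <= a < 1 -> 0 <= b < 1 ->
  expi (- (2 * pi * a)) = expi (- (2 * pi * b)) -> a = b.
Proof.
wlog ab : a b / a <= b.
  move=> H ha hb; case: (leP a b) => [ab|/ltW ba]; first exact: H.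
  by move=> /esym e; apply/esym/H.
move=> /andP[a0 a1] /andP[b0 b1] e; have := pi_gt0 R => pi0.
suff /eqP : 2 * pi * (b - a) = 0.
  by rewrite !mulf_eq0 pnatr_eq0 (gt_eqF pi0) /= subr_eq0 => /eqP ->.
apply: expi_eq1.
  apply/andP; split; first by apply: mulr_ge0; lra.
  by rewrite gtr_pMr; lra.
have -> : 2 * pi * (b - a) = 2 * pi * b + - (2 * pi * a) by ring.
by rewrite expiD e -expiD subrr expi0.
Qed.

Lemma steeringE N (w : R) k : steering N w k 0 = expi (- (2 * pi * w)) ^+ k.
Proof.
rewrite mxE -expi_natmul; congr expi.
by rewrite -mulr_natr; ring.
Qed.

Lemma steering_neq0 N (w : R) : steering N w != 0.
Proof.
apply/eqP => /colP/(_ 0); rewrite steeringE expr0 mxE => /eqP.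
by rewrite oner_eq0.
Qed.

Variables (s : nat) (omega : 'I_s -> R).

Lemma steering_mx_delta N j :
  steering_mx N omega *m delta_mx j 0 = steering N (omega j) :> 'cV_N.+1.
Proof. by rewrite -colE; apply/colP => k; rewrite !mxE. Qed.

(** The first s rows of the steering matrix form a Vandermonde matrix whose nodes are distinct,
    since the frequencies are distinct in [0, 1). *)
Lemma steering_mx_row_free N : (s <= N.+1)%N ->
  (forall j, 0 <= omega j < 1) -> injective omega ->
  row_free (steering_mx N omega)^T.
Proof.
move=> sN w_range w_inj; pose z := \row_j expi (- (2 * pi * omega j)).
have Vz : \det (Vandermonde s z) != 0.
  rewrite det_Vandermonde; apply/prodf_neq0 => i _; apply/prodf_neq0 => j ij.
  rewrite !mxE subr_eq0; apply/eqP => /expi_inj_range.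
  by move=> /(_ (w_range j) (w_range i))/w_inj e; rewrite e ltnn in ij.
(* [S] selects the first s columns of the transposed steering matrix, and a product has rank at most
   that of its left factor. *)
pose S : 'M[C]_(N.+1, s) := \matrix_(k, i) (k == widen_ord sN i)%:R.
have VE : (Vandermonde s z)^T = (steering_mx N omega)^T *m S.
  apply/matrixP => j i; rewrite !mxE (bigD1 (widen_ord sN i)) //= big1 => [|k ki].
    have -> : expi (- (2 * pi * omega j)) ^+ i =
        steering N (omega j) (widen_ord sN i) 0.
      by rewrite steeringE.
    by rewrite !mxE eqxx mulr1 addr0.
  by rewrite !mxE (negbTE ki) mulr0.
rewrite -row_leq_rank; apply: leq_trans (mxrankM_maxl _ S).
by rewrite -VE mxrank_tr row_leq_rank row_free_unit unitmxE unitfE Vz.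
Qed.

Lemma hankel_noiseless M L (x : 'I_s -> C) : (L <= M)%N ->
  hankel L (noiseless_data M omega x) =
  steering_mx L omega *m diag_mx (\row_j x j) *m (steering_mx (M - L) omega)^T.
Proof.
move=> LM; apply/matrixP => a b.
rewrite mxE [LHS]mxE [RHS]mxE; apply: eq_bigr => j _.
have abM : (a + b < M.+1)%N.
  by rewrite ltnS -[leqRHS](subnKC LM) leq_add // -ltnS.
transitivity (x j * steering M (omega j) (inord (a + b)) 0); first by rewrite mxE.
transitivity (steering L (omega j) a 0 * x j * steering (M - L) (omega j) b 0).
  by rewrite !steeringE inordK // exprD mulrCA mulrA.
by rewrite mul_mx_diag !mxE.
Qed.

End Steering.

(** * The smallest modulus of an amplitude *)

Section MinModulus.
Variable R : realType.
Lemma min_modulus_le (s : nat) (x : 'I_s -> R[i]) j : min_modulus x <= modulus (x j).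
Proof.
apply: ge_inf; last by exists j.
by exists 0 => _ [i _ <-]; exact: modulus_ge0.
Qed.

Lemma min_modulus_gt0 (s : nat) (x : 'I_s -> R[i]) : (0 < s)%N ->
  (forall j, x j != 0) -> 0 < min_modulus x.
Proof.
move=> s0 x0; pose i0 := Ordinal s0.
case: (@arg_minP _ _ _ i0 xpredT (fun j => modulus (x j)) erefl) => i _ xi.
have xi0 : 0 < modulus (x i).
  rewrite lt_def modulus_ge0 andbT; apply: contra (x0 i) => /eqP.
  by move/Normc.eq0_normc ->.
apply: (lt_le_trans xi0); apply: lb_le_inf; first by exists (modulus (x i)), i.
by move=> _ [j _ <-]; exact: xi.
Qed.
End MinModulus.

(** * The bounds for the Hankel matrices of the clean and noisy data *)

Theorem theorem3 (R : realType) (s L M : nat)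
    (s_gt0 : (0 < s)%N) (L_gt0 : (1 <= L)%N) (L_ltM : (L < M)%N)
    (omega : 'I_s -> R)
    (omega_range : forall j, 0 <= omega j < 1)
    (omega_inj : injective omega)
    (x : 'I_s -> R[i])
    (x_neq0 : forall j, x j != 0)
    (eps : 'cV[R[i]]_M.+1)
    (U Ueps : 'M[R[i]]_L.+1) (V Veps : 'M[R[i]]_((M - L).+1))
    (sigma sigmaeps : nat -> R) :
  let y := noiseless_data M omega x in
  let H := hankel L y in
  let E := hankel L eps in
  let Heps := hankel L (y + eps) in
  let P2 := noise_proj s U in
  let P2eps := noise_proj s Ueps in
  let sigma_1 := sigma 0%N in
  let sigma_s := sigma s.-1 in
  is_svd H U sigma V ->
  is_svd Heps Ueps sigmaeps Veps ->
  (s <= L)%N -> (s <= M - L + 1)%N ->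
  specnorm E < sigma_s ->
  (forall w : R, 0 <= w < 1 ->
     `|noise_correlation P2eps w - noise_correlation P2 w|
       <= specnorm (P2eps - P2)) /\
  specnorm (P2eps - P2)
    <= (4 * sigma_1 + 2 * specnorm E) / (sigma_s - specnorm E) ^+ 2
       * specnorm E /\
  (forall j : 'I_s,
     noise_correlation P2 (omega j) = 0 /\
     `|noise_correlation P2eps (omega j)|
       <= 2 * specnorm E
          / (min_modulus x * sigma_min (steering_mx (M - L) omega)^T
             * l2norm (steering L (omega j)))).
Proof.
move=> y H E Heps P2 P2eps sigma_1 sigma_s Hsvd Hepssvd sL sML dlt.
set d := specnorm E in dlt *.
have d0 : 0 <= d by exact: specnorm_ge0.
have phi_gt0 (w : R) : 0 < l2norm (steering L w) by rewrite l2norm_gt0 steering_neq0.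
have sn : (s <= (M - L).+1)%N by rewrite -addn1.
have smn : (0 < s <= minn L.+1 (M - L).+1)%N by rewrite s_gt0 leq_min sn ltnW.
have HE : H = _ := hankel_noiseless omega x (ltnW L_ltM).
have HepsE (v : 'cV_(M - L).+1) : l2norm (Heps *m v - H *m v) <= d * l2norm v.
  have -> : Heps = H + E by apply/matrixP => a b; rewrite !mxE.
  by rewrite mulmxDl addrC addKr; exact: l2norm_le_specnorm.
(* H factors through the s-row matrix of transposed steering vectors, so its rank is at most s. *)
have rankH j : (s <= j)%N -> (j < minn L.+1 (M - L).+1)%N -> sigma j = 0.
  apply: (svd_rank_le (N := (steering_mx (M - L) omega)^T) Hsvd) => v Nv.
  by rewrite HE -mulmxA Nv mulmx0.
split=> [w _|].
  rewrite /noise_correlation -mulrBl normrM normfV (gtr0_norm (phi_gt0 w)).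
  rewrite ler_pdivrMr //; apply: le_trans (l2norm_le_specnorm _ _).
  by rewrite mulmxBl; exact: ler_l2norm_dist.
split=> [|j].
  apply: specnorm_le => v.
  apply: le_trans (noise_proj_perturbation Hsvd Hepssvd smn rankH d0 HepsE dlt v) _.
  rewrite ler_wpM2r ?l2norm_ge0 // -/sigma_s.
  have s1 : sigma_s <= sigma_1.
    case: Hsvd => _ _ _ s_dec _; apply: s_dec => //.
    by rewrite prednK //; case/andP: smn.
  have a0 : 0 < sigma_s - d by rewrite subr_gt0.
  have ss0 : 0 < sigma_s by exact: le_lt_trans dlt.
  (* Lowering the denominator of 2 d / sigma_s to sigma_s - d gives 3 d / (sigma_s - d). Expanding
     this by sigma_s - d leaves the comparison 3 (sigma_s - d) <= 4 sigma_1 + 2 d. *)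
  apply: (@le_trans _ _ (3 * d / (sigma_s - d))).
    have -> : 3 * d / (sigma_s - d) = 2 * d / (sigma_s - d) + d / (sigma_s - d) by ring.
    rewrite lerD2r ler_wpM2l ?mulr_ge0 // lef_pV2 ?posrE //; lra.
  have -> : 3 * d / (sigma_s - d) = 3 * (sigma_s - d) / (sigma_s - d) ^+ 2 * d.
    by field; rewrite gt_eqF.
  by rewrite ler_wpM2r // ler_wpM2r ?invr_ge0 ?sqr_ge0 //; lra.
have Phi_free := steering_mx_row_free sn omega_range omega_inj.
have [smin_gt0 Phi_section] := sigma_min_section Phi_free s_gt0.
(* The factor 1 / x_j cancels the amplitude in the diagonal factor of H, so that H w is the j-th
   column of the left steering matrix. *)
have [w Aw wle] := Phi_section ((x j)^-1 *: delta_mx j 0).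
have Hw : H *m w = steering L (omega j).
  rewrite HE -mulmxA Aw -mulmxA -scalemxAr.
  have -> : diag_mx (\row_i x i) *m delta_mx j 0 = x j *: delta_mx j 0 :> 'cV_s.
    apply/colP => i; rewrite mul_diag_mx !mxE.
    by case: (eqVneq i j) => [->|_]; rewrite ?mulr0.
  by rewrite scalerA mulVf // scale1r steering_mx_delta.
have xmin_gt0 := min_modulus_gt0 s_gt0 x_neq0.
rewrite /noise_correlation -Hw (noise_proj_rank Hsvd rankH) l2norm0 mul0r; split=> //.
rewrite ger0_norm ?divr_ge0 ?l2norm_ge0 // [in X in _ <= X]invfM mulrA.
rewrite ler_wpM2r ?invr_ge0 ?l2norm_ge0 //.
apply: le_trans (l2norm_perturbed_noise_proj Hsvd Hepssvd rankH d0 HepsE w) _.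
rewrite ler_wpM2l ?mulr_ge0 //; apply: (le_trans wle).
(* The right-hand side e_j / x_j has norm 1 / |x_j|, at most the inverse of [min_modulus x]. *)
rewrite invfM [leRHS]mulrC ler_wpM2l ?invr_ge0 ?(ltW smin_gt0) // l2normZ l2norm_delta.
rewrite mulr1 /modulus Normc.normcV lef_pV2 ?posrE ?min_modulus_le //.
exact: lt_le_trans (min_modulus_le x j).
Qed.
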